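(* Let $T=(1,3,5^k,3,1)$ with $k=3$, i.e. $T=(1,3,5,5,5,3,1)$. There are exactly $43$ potential Jordan degree types for pairs $(A,\ell)$ with $A\in\mathrm{Gor}(T)$ and $\ell\in A_1$; equivalently, there are exactly $43$ potential rank matrices for $T$.
   Context: $\mathsf{k}$ is an infinite field of arbitrary characteristic, $R=\mathsf{k}[x,y,z]$ with the standard grading; $5^k$ means $5$ repeated $k$ times. $\mathrm{Gor}(T)$ is the family of graded Artinian Gorenstein (AG) quotients $A=R/I$ with Hilbert function $T=(t_0,\dots,t_j)$; $j$ is the socle degree and $s=\max_i t_i$. For a nonzero linear form $\ell\in A_1$, the rank matrix $M_{A,\ell}$ is the $(j+1)\times(j+1)$ upper triangular matrix (indices $0,\dots,j$) with $(u,v)$ entry, $u\le v$, the rank of $\ell^{v-u}:A_u\to A_v$. A potential rank matrix for $T$ is an upper triangular $(j+1)\times(j+1)$ matrix $M$ of non-negative integers, with rows and columns indexed by $0,\dots,j$, satisfying the known necessary conditions for rank matrices: (i) writing $H(i)=(M_{0,i},M_{1,i+1},\dots,M_{j-i,j})$ for the $i$-th diagonal, $H(0)=T$, $H(1)\ne 0$, and each $H(i)$ is either zero or the Hilbert function of a graded AG quotient of $R$ of socle degree $j-i$; (ii) each difference $H(i)-(0,H(i+1))$ is an O-sequence, i.e. zero or the Hilbert function of a standard graded algebra; (iii) in the upper triangular part, rows are non-increasing from left to right and columns are non-decreasing from top to bottom; (iv) $M_{u+1,v}+M_{u,v+1}\ge M_{u,v}+M_{u+1,v+1}$ whenever $0\le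 u<v<j$; (v) for all $u\le v$ with $t_u=t_v=s$, the entry $M_{u,v}$ depends only on $v-u$. The potential Jordan degree type associated with $M$ is the multiset of pairs $(p,\nu)$ (strings of length $p$ starting in degree $\nu$) in which $(v-u+1,u)$ has multiplicity $M_{u,v}+M_{u-1,v+1}-M_{u-1,v}-M_{u,v+1}$ for $0\le u\le v\le j$ (entries with indices out of range being $0$). This correspondence between potential rank matrices and potential Jordan degree types is one-to-one; for $M=M_{A,\ell}$ it gives the actual Jordan degree type of $(A,\ell)$, i.e. the lengths and initial degrees of the strings in a decomposition of $A$ into graded cyclic $\mathsf{k}[\ell]$-modules. *)

(* Defs.v *)
From HB Require Import structures.
From mathcomp Require Import all_boot all_order all_algebra.
From mathcomp Require Import finmap multiset mpoly.

Set Implicit Arguments.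
Unset Strict Implicit.
Unset Printing Implicit Defensive.

Import GRing.Theory.
Local Open Scope ring_scope.

Definition infinite_field (k : fieldType) : Prop :=
  forall s : seq k, exists x, x \notin s.

Definition has_exactly (X : eqType) (n : nat) (P : X -> Prop) : Prop :=
  exists s : seq X, [/\ uniq s, size s = n & forall x, x \in s <-> P x].

Section Algebras.
Variables (k : fieldType) (n : nat).
Implicit Types (I : {pred {mpoly k[n]}}) (f g : {mpoly k[n]}).

(* [idealr_closed] includes 1 \notin I, so that the quotient by I is nonzero. *)
Definition homogeneous_ideal I : Prop :=
  idealr_closed I /\
  (forall f, f \in I -> forall d, pihomog mdeg d f \in I).

(* dim_k (k[x_1..x_n] / I)_d = h, for a homogeneous ideal I: there are h forms
   of degree d whose classes are a basis of the degree d part of the quotient. *)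
Definition quotient_dim I (d h : nat) : Prop :=
  exists b : 'I_h -> {mpoly k[n]},
    [/\ forall i, b i \is d.-homog,
        forall c : 'I_h -> k, \sum_i c i *: b i \in I -> forall i, c i = 0
      & forall f, f \is d.-homog ->
          exists c : 'I_h -> k, f - \sum_i c i *: b i \in I].

Definition hilbert_function I (h : nat -> nat) : Prop :=
  forall d, quotient_dim I d (h d).

Definition in_socle I f : Prop := forall i : 'I_n, f * 'X_i \in I.

Definition socle_dim1 I : Prop :=
  exists g, [/\ in_socle I g, g \notin I
              & forall f, in_socle I f -> exists c : k, f - c *: g \in I].

Definition top_degree I (j : nat) : Prop :=
  ~ quotient_dim I j 0 /\ (forall d, (j < d)%N -> quotient_dim I d 0).

(* The quotient by I is graded Artinian Gorenstein of socle degree j; it is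
   Artinian because it vanishes in degrees > j, and its socle, being
   one-dimensional, lies in the top degree j. *)
Definition AG_ideal I (j : nat) : Prop :=
  [/\ homogeneous_ideal I, top_degree I j & socle_dim1 I].

End Algebras.

(* Hilbert functions are functions on nat, zero past the last listed term. *)
Definition zero_seq (h : nat -> nat) : Prop := forall d, h d = 0%N.

Definition AG_sequence (k : fieldType) (j : nat) (h : nat -> nat) : Prop :=
  exists I : {pred {mpoly k[3]}}, AG_ideal I j /\ hilbert_function I h.

Definition O_sequence (k : fieldType) (h : nat -> nat) : Prop :=
  zero_seq h \/
  exists n (I : {pred {mpoly k[n]}}),
    homogeneous_ideal I /\ hilbert_function I h.

(* The sequence (0, h 0, h 1, ...). *)
Definition shift (h : nat -> nat) (d : nat) : nat :=
  if d is e.+1 then h e else 0%N.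

Section RankMatrices.
Local Open Scope nat_scope.

Definition entry (m : nat) (M : 'M[nat]_m) (u v : nat) : nat :=
  if insub u is Some i then if insub v is Some j then M i j else 0 else 0.

Definition diagonal (m : nat) (M : 'M[nat]_m) (i d : nat) : nat :=
  entry M d (d + i).

Definition potential_rank_matrix (k : fieldType) (T : seq nat)
    (M : 'M[nat]_(size T)) : Prop :=
  let j := (size T).-1 in
  let s := \max_(t <- T) t in
  let t := nth 0 T in
  let m := entry M in
  let H := diagonal M in
  [/\ forall u v, v < u -> m u v = 0,
      [/\ forall d, H 0 d = t d,
          ~ zero_seq (H 1)
        & forall i, i <= j -> zero_seq (H i) \/ AG_sequence k (j - i) (H i)],
      (* h is the difference H(i) - (0, H(i+1)). *)
      forall i, i <= j -> exists2 h, O_sequence k h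
        & forall d, H i d = shift (H i.+1) d + h d,
      (forall u v, u <= v -> v < j -> m u v.+1 <= m u v) /\
      (forall u v, u < v -> v <= j -> m u v <= m u.+1 v)
    & (forall u v, u < v -> v < j ->
         m u v + m u.+1 v.+1 <= m u.+1 v + m u v.+1) /\
      (forall u v u' v', u <= v -> v <= j -> u' <= v' -> v' <= j ->
         t u = s -> t v = s -> t u' = s -> t v' = s ->
         v - u = v' - u' -> m u v = m u' v')].

(* Number of strings of length v - u + 1 starting in degree u. For a potential
   rank matrix and u <= v the subtraction is never truncated: this is the
   inequality on 2 x 2 blocks, or monotonicity of rows or columns when u = 0 or
   v = j. *)
Definition string_mult (m : nat) (M : 'M[nat]_m) (u v : nat) : nat :=
  (entry M u v + shift (fun w => entry M w v.+1) u)
  - (shift (fun w => entry M w v) u + entry M u v.+1).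

(* Pairs (length, initial degree). *)
Definition jordan_degree_type (m : nat) (M : 'M[nat]_m) :
    {mset (nat * nat)%type}%mset :=
  \big[@msetD _/mset0]_(u < m) \big[@msetD _/mset0]_(v < m | u <= v)
    msetn (string_mult M u v) (v - u + 1, nat_of_ord u).

Definition potential_jordan_degree_type (k : fieldType) (T : seq nat)
    (D : {mset (nat * nat)%type}%mset) : Prop :=
  exists2 M : 'M[nat]_(size T), potential_rank_matrix k M
                              & D = jordan_degree_type M.

End RankMatrices.

(* Main.v *)
Require Import Defs.
From mathcomp Require Import all_boot all_algebra.
From mathcomp Require Import finmap multiset.
From HB Require Import structures.
From mathcomp Require Import mpoly.
From mathcomp Require Import zify ring.
From Stdlib Require Import ClassicalEpsilon FunctionalExtensionality.

Set Implicit Arguments.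
Unset Strict Implicit.
Unset Printing Implicit Defensive.

(** A potential rank matrix for (1,3,5,5,5,3,1) is the list of its diagonals
    H(0) = T, H(1), ..., H(6), so the proof is a finite search once the
    algebraic conditions on the diagonals have become numerical.

    Necessity.  Multiplication into the top degree is a perfect pairing on a
    Gorenstein quotient, so each nonzero H(i) is symmetric with value 1 in
    degree 0 ([AG_sequence_spec]).  As the rows of the matrix bound its entries
    by T, such an H(i) is determined by its values b <= 3 and c <= 5 in degrees
    1 and 2.  For the differences H(i) - (0, H(i+1)) two cases of Macaulay's
    growth bound suffice ([O_sequence_spec]): if h_d <= d then h_(d+1) <= h_d,
    and h_2 <= C(h_1 + 1, 2).  Both have a short proof by induction on graded
    modules.  A variable x that does not kill a graded module V splits it into
    V / xV and xV, both again generated in degree 0 after a shift of xV; the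
    dimensions of V are the sums of theirs, and those of xV are at most the
    dimensions of V one degree lower.  Filtering the candidate lists of diagonals
    by these numerical conditions leaves 43 of them.

    Sufficiency.  Every diagonal and every difference that occurs in the 43
    lists is realised by a Macaulay inverse system: the ideal of the polynomials
    that annihilate given sums of monomials under contraction.  Contraction
    involves no factorials, so the construction is independent of the
    characteristic.  One homogeneous sum defines a Gorenstein ideal
    ([inverse_ideal_AG]); a set of single monomials defines the monomial ideal
    whose standard monomials are their divisors.  All generators used here have the property that
    the catalecticant rows of two monomials of equal degree are equal or
    disjoint, so that a Hilbert function can be read off from lists of exponents
    ([has_hilbert_functionP]), and the witnesses are checked by computation.

    Finally a Jordan degree type determines the multiplicities of its strings,
    and these multiplicities separate the 43 matrices. *)

(** * Growth of graded modules generated in degree 0 *)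

Section GradedModules.
Import GRing.Theory.
Local Open Scope ring_scope.
Variables (F : fieldType) (n : nat).

(** The graded module is V / U, presented by row spaces U d <= V d inside
    ambient spaces N d on which commuting variables act.  With a fixed ambient
    action, a quotient of the module only enlarges U and a submodule only
    shrinks V.  The last condition says that V / U is generated in degree 0. *)
Definition graded_module (N : nat -> nat)
    (X : 'I_n -> forall d, 'M[F]_(N d, N d.+1)) (U V : forall d, 'M[F]_(N d)) :=
  [/\ forall i l d, X i d *m X l d.+1 = X l d *m X i d.+1,
      forall d, (U d <= V d)%MS,
      forall i d, (U d *m X i d <= U d.+1)%MS
    & forall d, (V d.+1 :=: U d.+1 + \sum_i <<V d *m X i d>>)%MS].

Definition relative_rank (m : nat) (U V : 'M[F]_m) := (\rank V - \rank U)%N.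

(** The relations of the quotient of V / U by its multiples of the i-th variable. *)
Definition quotient_sub (N : nat -> nat)
    (X : 'I_n -> forall d, 'M[F]_(N d, N d.+1)) (U V : forall d, 'M[F]_(N d))
    (i : 'I_n) (d : nat) : 'M[F]_(N d) :=
  if d is e.+1 then (U e.+1 + V e *m X i e)%MS else U 0%N.

Lemma graded_moduleX N X U V i d :
  @graded_module N X U V -> (V d *m X i d <= V d.+1)%MS.
Proof.
case=> _ _ _ gen; rewrite gen; apply: submx_trans (addsmxSr _ _).
by apply: (sumsmx_sup i); rewrite ?genmxE.
Qed.

Lemma graded_module_quotient N X U V i :
  @graded_module N X U V -> graded_module X (quotient_sub X U V i) V.
Proof.
move=> gm; have VX l d := graded_moduleX l d gm.
have [comm UV UX gen] := gm.
have UU d : (U d <= quotient_sub X U V i d)%MS by case: d => [|d] //=; apply: addsmxSl.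
have U'V d : (quotient_sub X U V i d <= V d)%MS.
  by case: d => [|d] //=; rewrite addsmx_sub UV VX.
split=> // [l [|d]|d] /=.
- by apply: submx_trans (UX l 0%N) (addsmxSl _ _).
- rewrite addsmxMr addsmxS //.
  by rewrite -mulmxA comm mulmxA submxMr.
- apply/eqmxP/andP; split.
    by rewrite {1}gen addsmxS // UU.
  rewrite addsmx_sub U'V; apply/sumsmx_subP=> l _; rewrite genmxE; exact: VX.
Qed.

(** The multiples x_i (V / U), shifted down by one degree so that they are again
    generated in degree 0: commutation of the variables turns generation of V
    into generation of its image. *)
Lemma graded_module_image N X U V i :
  @graded_module N X U V ->
  graded_module (fun l d => X l d.+1) (fun d => U d.+1)
    (fun d => U d.+1 + V d *m X i d)%MS.
Proof.
move=> gm; have VX l d := graded_moduleX l d gm.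
have [comm UV UX gen] := gm.
split=> // [d|d]; first exact: addsmxSl.
apply/eqmxP/andP; split.
  have VS : (V d.+1 <= U d.+1 + \sum_l <<V d *m X l d>>)%MS by rewrite gen.
  rewrite addsmx_sub addsmxSl; apply: submx_trans (submxMr _ VS) _.
  rewrite addsmxMr addsmxS // sumsmxMr_gen; apply/sumsmx_subP => l _.
  rewrite !genmxE (eqmxMr _ (genmxE _)).
  rewrite -mulmxA comm mulmxA; apply: (sumsmx_sup l) => //.
  by rewrite genmxE submxMr // addsmxSr.
rewrite addsmx_sub addsmxSl; apply/sumsmx_subP => l _.
rewrite genmxE addsmxMr addsmxS // -mulmxA comm mulmxA submxMr //.
Qed.

(** Multiplication induces a surjection from V / U onto (W + V A) / W. *)
Lemma relative_rank_image (p q : nat) (A : 'M[F]_(p, q)) (U V : 'M[F]_p) (W : 'M[F]_q) :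
  (U <= V)%MS -> (U *m A <= W)%MS ->
  (relative_rank W (W + V *m A)%MS <= relative_rank U V)%N.
Proof.
move=> UV UAW; rewrite /relative_rank leq_subLR.
have capU : (V :&: U :=: U)%MS by apply/eqmxP; rewrite capmxSr sub_capmx UV submx_refl.
have := mxrank_cap_compl V U; rewrite capU => rk.
have sub : (W + V *m A <= W + (V :\: U) *m A)%MS.
  rewrite addsmx_sub addsmxSl.
  apply: (submx_trans (submxMr _ (_ : _ <= (V :\: U) + (V :&: U))%MS)).
    by rewrite addsmx_diff_cap_eq.
  rewrite addsmxMr addsmx_sub addsmxSr (eqmxMr _ capU).
  exact: submx_trans UAW (addsmxSl _ _).
have r1 := mxrankS sub.
have r3 := mxrankM_maxl (V :\: U)%MS A.
have [r4 _] := mxrank_adds_leqif W ((V :\: U)%MS *m A).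
lia.
Qed.

Lemma relative_rank_split (p : nat) (U W V : 'M[F]_p) :
  (U <= W)%MS -> (W <= V)%MS ->
  relative_rank U V = (relative_rank W V + relative_rank U W)%N.
Proof. by move=> /mxrankS UW /mxrankS WV; rewrite /relative_rank; lia. Qed.

Lemma relative_rank0 (p : nat) (U V : 'M[F]_p) :
  (U <= V)%MS -> relative_rank U V = 0%N -> (V <= U)%MS.
Proof.
move=> UV /eqP; rewrite subn_eq0 => rk.
by have [_] := mxrank_leqif_sup UV; rewrite eqn_leq (mxrankS UV) rk => <-.
Qed.

Lemma relative_rank_ge1 (p : nat) (U V : 'M[F]_p) :
  (U <= V)%MS -> ~~ (V <= U)%MS -> (0 < relative_rank U V)%N.
Proof. by move=> UV; apply: contraNT; rewrite -eqn0Ngt => /eqP /relative_rank0 ->. Qed.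

Lemma relative_rank_sub (p : nat) (U V : 'M[F]_p) :
  (V <= U)%MS -> relative_rank U V = 0%N.
Proof. by move=> /mxrankS; rewrite /relative_rank; lia. Qed.

Lemma relative_rank_stop N X U V d : @graded_module N X U V ->
  relative_rank (U d) (V d) = 0%N -> relative_rank (U d.+1) (V d.+1) = 0%N.
Proof.
case=> comm UV UX gen /relative_rank0 -/(_ (UV d)) VU.
apply: relative_rank_sub; rewrite gen addsmx_sub submx_refl.
apply/sumsmx_subP => l _; rewrite genmxE; exact: submx_trans (submxMr _ VU) (UX l d).
Qed.

(** Since degree d + 1 is spanned by the products of the variables with
    degree d, some variable is nonzero on degree d. *)
Lemma moving_variable N X U V d : @graded_module N X U V ->
  (0 < relative_rank (U d.+1) (V d.+1))%N ->
  exists i, (0 < relative_rank (U d.+1) (U d.+1 + V d *m X i d)%MS)%N.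
Proof.
case=> comm UV UX gen pos.
have [i nle] : exists i, ~~ (V d *m X i d <= U d.+1)%MS.
  apply/existsP; apply: contraLR pos => /existsPn sub; rewrite -eqn0Ngt.
  rewrite relative_rank_sub // gen addsmx_sub submx_refl.
  by apply/sumsmx_subP => l _; rewrite genmxE; have := sub l; rewrite negbK.
exists i; apply: relative_rank_ge1; first exact: addsmxSl.
by apply: contra nle; apply: submx_trans (addsmxSr _ _).
Qed.

(** Split V / U into its quotient and its image under a variable x with
    nonzero image in degree d + 1.  The quotient has smaller dimension there, so
    the inner induction on the dimension applies to it.  If the quotient does
    not vanish, the image has dimension at most d in its own degree d, and the
    outer induction on d applies; if it does vanish, degree d + 2 consists of
    multiples of x and is the image of degree d + 1. *)
Lemma relative_rank_decr d : forall N X U V, @graded_module N X U V ->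
  (relative_rank (U d) (V d) <= d)%N ->
  (relative_rank (U d.+1) (V d.+1) <= relative_rank (U d) (V d))%N.
Proof.
elim: d => [|d IHd] N X U V gm.
  by rewrite leqn0 => /eqP r0; rewrite (relative_rank_stop gm r0).
have [r] := ubnP (relative_rank (U d.+1) (V d.+1)).
elim: r U V gm => // r IHr U V gm; rewrite ltnS => ler led.
have [r0|pos] := posnP (relative_rank (U d.+1) (V d.+1)).
  by rewrite (relative_rank_stop gm r0).
have [i bpos] := moving_variable gm pos.
have qm := graded_module_quotient i gm.
have im := graded_module_image i gm.
have [comm UV UX gen] := gm; have [_ UV' _ _] := qm.
have split1 e := relative_rank_split (addsmxSl (U e.+1) (V e *m X i e)) (UV' e.+1).
rewrite !split1.
have a_le := IHr _ _ qm.
have b_le := IHd _ _ _ _ im.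
have b_le2 := relative_rank_image (UV d.+1) (UX i d.+1).
have a0 := relative_rank_stop (d := d.+1) qm.
rewrite /= in a_le a0 b_le b_le2.
move: ler led b_le2; rewrite split1 => ler led b_le2.
lia.
Qed.

(** The same splitting in degrees 1 and 2: the image part of degree 2 has
    dimension at most h_1, and h_1 drops in the quotient, which gives
    h_1 + (h_1 - 1) + ... + 1. *)
Lemma relative_rank_quadrics N X U V : @graded_module N X U V ->
  (relative_rank (U 2) (V 2) <= 'C((relative_rank (U 1) (V 1)).+1, 2))%N.
Proof.
move=> gm; have [r] := ubnP (relative_rank (U 1%N) (V 1%N)).
elim: r U V gm => // r IHr U V gm; rewrite ltnS => ler.
have [r0|pos] := posnP (relative_rank (U 1%N) (V 1%N)).
  by rewrite (relative_rank_stop gm r0).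
have [i bpos] := moving_variable gm pos.
have qm := graded_module_quotient i gm.
have [comm UV UX gen] := gm; have [_ UV' _ _] := qm.
have split1 e := relative_rank_split (addsmxSl (U e.+1) (V e *m X i e)) (UV' e.+1).
have b_le := relative_rank_image (UV 1%N) (UX i 1%N).
have := IHr _ _ qm; rewrite (split1 1%N) /=.
move: ler b_le; rewrite split1.
set a := relative_rank _ (V 1%N); set b := relative_rank _ (addsmx _ _) in bpos *.
move=> ler b_le /(_ _) a_le.
have {}a_le := a_le ltac:(lia).
apply: leq_trans (leq_add a_le b_le) _.
rewrite (binS (a + b) 1) bin1 leq_add2r.
apply: leq_bin2l; lia.
Qed.

End GradedModules.

(** * Quotients by homogeneous ideals as graded modules *)

Section Ideals.
Import GRing.Theory.
Local Open Scope ring_scope.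
Variables (k : fieldType) (n : nat) (I : {pred {mpoly k[n]}}).
Hypothesis homI : homogeneous_ideal I.
Implicit Types f g u v : {mpoly k[n]}.

Lemma ideal0 : 0 \in I.
Proof. by case: homI => -[]. Qed.

Lemma ideal1 : 1 \notin I.
Proof. by case: homI => -[]. Qed.

Lemma idealD u v : u \in I -> v \in I -> u + v \in I.
Proof. by case: homI => -[_ _ cl] _ uI vI; rewrite -[u]mul1r cl. Qed.

Lemma idealM f u : u \in I -> f * u \in I.
Proof. by case: homI => -[I0 _ cl] _ uI; rewrite -[_ * _]addr0 cl. Qed.

Lemma idealZ c u : u \in I -> c *: u \in I.
Proof. by rewrite -mul_mpolyC; exact: idealM. Qed.

Lemma idealB u v : u \in I -> v \in I -> u - v \in I.
Proof. by move=> uI vI; rewrite -scaleN1r idealD ?idealZ. Qed.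

Lemma ideal_sum (J : finType) (f : J -> {mpoly k[n]}) :
  (forall i, f i \in I) -> \sum_i f i \in I.
Proof.
move=> fI; elim/big_ind: _ => [|u v|i _] //; [exact: ideal0 | exact: idealD].
Qed.

End Ideals.

Section QuotientCoordinates.
Import GRing.Theory.
Local Open Scope ring_scope.
Variables (k : fieldType) (n : nat) (I : {pred {mpoly k[n]}}) (h : nat -> nat).
Hypotheses (homI : homogeneous_ideal I) (hfI : hilbert_function I h).
Implicit Types f g u v : {mpoly k[n]}.

Definition quotient_basis d : 'I_(h d) -> {mpoly k[n]} :=
  proj1_sig (constructive_indefinite_description _ (hfI d)).

Notation b := quotient_basis.

Definition combination d (c : 'rV[k]_(h d)) : {mpoly k[n]} :=
  \sum_i c 0 i *: @b d i.

Lemma quotient_basis_homog d i : @b d i \is d.-homog.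
Proof.
by rewrite /quotient_basis; case: constructive_indefinite_description => ? [].
Qed.

Lemma combination_free d c : @combination d c \in I -> c = 0.
Proof.
rewrite /combination /quotient_basis.
case: constructive_indefinite_description => b /= [_ free _] /free c0.
by apply/rowP => i; rewrite c0 mxE.
Qed.

Lemma combination_span d f :
  exists c, f \is d.-homog -> f - @combination d c \in I.
Proof.
rewrite /combination /quotient_basis.
case: constructive_indefinite_description => b /= [_ _ span].
case: (boolP (f \is d.-homog)) => [/span [c fc]|]; last by exists 0.
by exists (\row_i c i) => _; under eq_bigr do rewrite mxE.
Qed.

(** Coordinates of the class of f in the chosen basis of the degree d part of
    the quotient; meaningful only when f is homogeneous of degree d. *)
Definition coords d f : 'rV[k]_(h d) :=
  proj1_sig (constructive_indefinite_description _ (combination_span d f)).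

Lemma coordsP d f : f \is d.-homog -> f - combination (coords d f) \in I.
Proof.
by rewrite /coords; case: constructive_indefinite_description.
Qed.

Lemma combinationD d c e : @combination d (c + e) = combination c + combination e.
Proof. by rewrite -big_split; apply: eq_bigr => i _; rewrite mxE scalerDl. Qed.

Lemma combinationZ d a c : @combination d (a *: c) = a *: combination c.
Proof. by rewrite scaler_sumr; apply: eq_bigr => i _; rewrite mxE scalerA. Qed.

Lemma combinationB d c e : @combination d (c - e) = combination c - combination e.
Proof. by rewrite combinationD -scaleN1r combinationZ scaleN1r. Qed.

(** Independence of the basis modulo the ideal makes coordinates unique, and
    every algebraic property of coordinates below follows from that. *)
Lemma coords_unique d f c :
  f \is d.-homog -> f - @combination d c \in I -> coords d f = c.
Proof.
move=> hf fc; apply/eqP; rewrite -subr_eq0; apply/eqP/combination_free.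
rewrite combinationB.
have -> : combination (coords d f) - combination c =
   (f - combination c) - (f - combination (coords d f)) by ring.
by apply: (idealB homI) (coordsP hf).
Qed.

Lemma combination_homog d c : @combination d c \is d.-homog.
Proof. by apply: rpred_sum => i _; rewrite rpredZ ?quotient_basis_homog. Qed.

Lemma coords_combination d c : coords d (combination c) = c.
Proof.
by apply: coords_unique; rewrite ?combination_homog // subrr ideal0.
Qed.

Lemma coordsD d f g : f \is d.-homog -> g \is d.-homog ->
  coords d (f + g) = coords d f + coords d g.
Proof.
move=> hf hg; apply: coords_unique; first exact: rpredD.
by rewrite combinationD opprD addrACA (idealD homI) ?coordsP.
Qed.

Lemma coordsZ d a f : f \is d.-homog -> coords d (a *: f) = a *: coords d f.
Proof.
move=> hf; apply: coords_unique; first exact: rpredZ.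
by rewrite combinationZ -scalerBr (idealZ homI) ?coordsP.
Qed.

Lemma coords_eq0 d f : f \is d.-homog -> (coords d f == 0) = (f \in I).
Proof.
move=> hf; apply/eqP/idP => [c0|fI].
  have := coordsP hf; rewrite c0 /combination big1 ?subr0 // => i _.
  by rewrite mxE scale0r.
apply: coords_unique => //; rewrite /combination big1 ?subr0 // => i _.
by rewrite mxE scale0r.
Qed.

Lemma coords_lincomb d (J : finType) (c : J -> k) (f : J -> {mpoly k[n]}) :
  (forall l, f l \is d.-homog) ->
  coords d (\sum_l c l *: f l) = \sum_l c l *: coords d (f l).
Proof.
move=> hf; elim: (index_enum J) => [|l r IH].
  by rewrite !big_nil; apply/eqP; rewrite coords_eq0 ?rpred0 ?ideal0.
have hcf l' : c l' *: f l' \is d.-homog by apply/rpredZ/hf.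
by rewrite !big_cons coordsD ?coordsZ ?IH //; apply: rpred_sum => l' _.
Qed.

Definition mulX_mx (i : 'I_n) d : 'M[k]_(h d, h d.+1) :=
  \matrix_l coords d.+1 (@b d l * 'X_i).

Lemma dhomogMX d i f : f \is d.-homog -> f * 'X_i \is d.+1.-homog.
Proof.
move=> hf; rewrite -addn1; apply: dhomogM => //.
by rewrite dhomogX; apply/eqP/mdeg1.
Qed.

Lemma coords_mulX d i f : f \is d.-homog ->
  coords d.+1 (f * 'X_i) = coords d f *m mulX_mx i d.
Proof.
move=> hf; apply: coords_unique; first exact: dhomogMX.
have -> : combination (coords d f *m mulX_mx i d) =
    \sum_l coords d f 0 l *: combination (coords d.+1 (@b d l * 'X_i)).
  rewrite /combination; under [RHS]eq_bigr do rewrite scaler_sumr.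
  rewrite exchange_big; apply: eq_bigr => m _.
  rewrite mxE scaler_suml; apply: eq_bigr => l _.
  by rewrite mxE scalerA.
have -> : f * 'X_i - \sum_l coords d f 0 l *: combination (coords d.+1 (@b d l * 'X_i))
  = 'X_i * (f - combination (coords d f)) +
   \sum_l coords d f 0 l *: (@b d l * 'X_i - combination (coords d.+1 (@b d l * 'X_i))).
  under [X in _ = _ + X]eq_bigr do rewrite scalerBr.
  rewrite sumrB mulrBr mulrC addrA; congr (_ - _).
  rewrite -addrA -[LHS]addr0; congr (_ + _).
  rewrite mulr_sumr -sumrN -big_split big1 //= => l _.
  by rewrite mulrC -scalerAl addNr.
apply: (idealD homI); rewrite ?(idealM homI) ?coordsP //.
apply: (ideal_sum homI) => l.
by rewrite (idealZ homI) ?coordsP // dhomogMX ?quotient_basis_homog.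
Qed.

Lemma coords_basis d l : coords d (@b d l) = delta_mx 0 l.
Proof.
rewrite -[RHS]coords_combination; congr coords.
rewrite /combination (bigD1 l) //= mxE !eqxx scale1r big1 ?addr0 // => i ne.
by rewrite mxE (negPf ne) andbF scale0r.
Qed.

(** Every monomial of positive degree is a multiple of a variable. *)
Lemma coords_generated d f : f \is d.+1.-homog ->
  (coords d.+1 f <= \sum_i <<mulX_mx i d>>)%MS.
Proof.
move=> hf; rewrite (mpolyE f) big_seq_cond.
set P := fun g => g \is d.+1.-homog /\ (coords d.+1 g <= \sum_i <<mulX_mx i d>>)%MS.
suff [] : P (\sum_(i <- msupp f | (i \in msupp f) && true) f@_i *: 'X_[i]) by [].
apply: big_ind => [|g1 g2 [h1 c1] [h2 c2]|m /andP[mf _]].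
- split; first exact: rpred0.
  suff -> : coords d.+1 0 = 0 by apply: sub0mx.
  by apply/eqP; rewrite coords_eq0 ?rpred0 ?ideal0.
- by split; [exact: rpredD | rewrite coordsD // addmx_sub].
have mdm : mdeg m = d.+1 by move/dhomogP: hf; apply.
have hm : ('X_[m] : {mpoly k[n]}) \is d.+1.-homog by rewrite dhomogX; apply/eqP.
split; first exact: rpredZ.
rewrite coordsZ //; apply: scalemx_sub.
have [i mi] : exists i, (0 < m i)%N.
  apply/existsP; apply: contra_eqT mdm => /existsPn m0.
  rewrite mdegE big1 // => i _; apply/eqP; by rewrite -leqn0 leqNgt m0.
have mE : m = ((m - U_(i)) + U_(i))%MM.
  apply/mnmP => l; rewrite mnmDE mnmBE mnm1E; case: eqP => [<-|_] /=; lia.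
have m'd : mdeg (m - U_(i))%MM = d.
  by move: mdm; rewrite {1}mE mdegD mdeg1; lia.
rewrite mE mpolyXD coords_mulX; last by rewrite dhomogX; apply/eqP.
apply: (sumsmx_sup i) => //; rewrite genmxE; exact: submxMl.
Qed.

Lemma quotient_graded_module :
  graded_module mulX_mx (fun d => 0) (fun d => 1%:M).
Proof.
split=> [i l d|d|i d|d].
- apply/row_matrixP => m; rewrite !row_mul !rowK.
  by rewrite -!coords_mulX ?dhomogMX ?quotient_basis_homog // mulrAC.
- exact: sub0mx.
- by rewrite mul0mx sub0mx.
apply/eqmxP; rewrite submx1 andbT; apply/row_subP => l.
rewrite rowE mulmx1 -coords_basis.
apply: submx_trans (addsmxSr _ _).
under eq_bigr do rewrite mul1mx.
by apply: coords_generated; exact: quotient_basis_homog.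
Qed.

Lemma hilbert_function_decr d : (h d <= d)%N -> (h d.+1 <= h d)%N.
Proof.
have := relative_rank_decr (d := d) quotient_graded_module.
by rewrite /relative_rank !mxrank1 !mxrank0 !subn0.
Qed.

Lemma hilbert_function_quadrics : (h 2 <= 'C((h 1).+1, 2))%N.
Proof.
have := relative_rank_quadrics quotient_graded_module.
by rewrite /relative_rank !mxrank1 !mxrank0 !subn0.
Qed.

(** Two basis elements would both be multiples of g, and the obvious relation
    between these multiples contradicts independence. *)
Lemma quotient_le1 d g :
  (forall f, f \is d.-homog -> exists c : k, f - c *: g \in I) -> (h d <= 1)%N.
Proof.
have [b [hb free _]] := hfI d => span; rewrite leqNgt; apply/negP => hd.
pose i0 : 'I_(h d) := Ordinal (ltnW hd); pose i1 := Ordinal hd.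
have [c0 c0P] := span _ (hb i0); have [c1 c1P] := span _ (hb i1).
pose c i := if i == i0 then c1 else if i == i1 then - c0 else 0.
have comb x y : \sum_i (if i == i0 then x else if i == i1 then y else 0) *: b i
    = x *: b i0 + y *: b i1.
  rewrite (bigD1 i0) //= (bigD1 i1) //= big1 ?addr0 // => i /andP[ne0 ne1].
  by rewrite (negPf ne0) (negPf ne1) scale0r.
have c00 : c0 = 0 /\ c1 = 0.
  have /free cz : \sum_i c i *: b i \in I.
    rewrite comb scaleNr; have -> : c1 *: b i0 - c0 *: b i1 =
      c1 *: (b i0 - c0 *: g) - c0 *: (b i1 - c1 *: g).
      by rewrite !scalerBr !scalerA (mulrC c0) opprB addrA subrK.
    by rewrite (idealB homI) ?(idealZ homI).
  have := cz i1; have := cz i0; rewrite /c !eqxx /= => -> /eqP.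
  by rewrite oppr_eq0 => /eqP.
have {}c00 : b i0 \in I by case: c00 c0P => -> _; rewrite scale0r subr0.
have : \sum_i (if i == i0 then 1 else if i == i1 then 0 else 0) *: b i \in I.
  by rewrite comb scale1r scale0r addr0.
by move/free/(_ i0); rewrite eqxx => /eqP; rewrite oner_eq0.
Qed.

Lemma quotient_eq0 d : (forall f, f \is d.-homog -> f \in I) -> h d = 0%N.
Proof.
have [b [hb free _]] := hfI d => sub; apply/eqP; rewrite eqn0Ngt; apply/negP => hd.
have /free/(_ (Ordinal hd))/eqP : \sum_i 1 *: b i \in I.
  by apply: (ideal_sum homI) => // i; rewrite scale1r sub.
by rewrite oner_eq0.
Qed.

Lemma hilbert_function0 : h 0 = 1%N.
Proof.
apply/eqP; rewrite eqn_leq; apply/andP; split.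
  apply: (@quotient_le1 0 1) => f /dhomogP hf.
  exists f@_0; suff {1}-> : f = f@_0 *: 1 by rewrite subrr ideal0.
  apply/mpolyP => m; rewrite mcoeffZ mcoeff1.
  have [->|nz] := eqVneq m 0%MM; rewrite ?mulr1 ?mulr0 //.
  apply/eqP; rewrite mcoeff_eq0; apply: contra nz => /hf /eqP.
  by rewrite mdeg_eq0.
rewrite lt0n; apply: contra (ideal1 homI) => /eqP h0.
have [b [_ _ span]] := hfI 0; have [c] := span 1 (dhomog1 _ _).
rewrite big1 ?subr0 // => i _; by have := ltn_ord i; rewrite [X in (_ < X)%N]h0.
Qed.

End QuotientCoordinates.

(** * Symmetry of Gorenstein Hilbert functions *)

Section Gorenstein.
Import GRing.Theory.
Local Open Scope ring_scope.
Variables (k : fieldType) (n : nat) (I : {pred {mpoly k[n]}}) (j : nat).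
Hypothesis AG : AG_ideal I j.
Implicit Types f g : {mpoly k[n]}.

Let homI : homogeneous_ideal I. Proof. by case: AG. Qed.

Lemma AG_above f d : (j < d)%N -> f \is d.-homog -> f \in I.
Proof.
case: AG => _ [_ van] _ jd hf; have [b [_ _ span]] := van d jd.
by have [c] := span f hf; rewrite big_ord0 subr0.
Qed.

Lemma AG_top_nonzero : exists2 t, t \is j.-homog & t \notin I.
Proof.
case: AG => _ [ntop _] _; apply: NNPP => nt; apply: ntop.
exists (fun _ => 0); split=> [[]//|c _ []//|f hf]; exists (fun _ => 0).
rewrite big_ord0 subr0; apply: contraT => fI; case: nt; by exists f.
Qed.

(** The top degree is nonzero and lies in the one-dimensional socle, so a socle
    element of degree d is proportional to one of degree j modulo the ideal;
    for d < j, the degree d component of that relation is f itself. *)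
Lemma AG_socle_homog d f : (d < j)%N -> f \is d.-homog -> in_socle I f -> f \in I.
Proof.
move=> dj hf sf; have [_ _ [g [sg gI gsp]]] := AG.
have [t ht tI] := AG_top_nonzero.
have st : in_socle I t by move=> i; apply: (@AG_above _ j.+1) => //; apply: dhomogMX.
have [c fc] := gsp f sf; have [e te] := gsp t st.
have e0 : e != 0 by apply: contra tI => /eqP e0; move: te; rewrite e0 scale0r subr0.
have : f - (c / e) *: t \in I.
  have -> : f - (c / e) *: t = (f - c *: g) - (c / e) *: (t - e *: g).
    by rewrite scalerBr scalerA divfK // opprB addrA subrK.
  by rewrite (idealB homI) // (idealZ homI).
case: homI => _ proj /proj /(_ d).
rewrite pihomogB pihomog_dE // linearZ /=.
rewrite (pihomog_ne0 _ ht) ?scaler0 ?subr0 //.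
by rewrite neq_ltn dj ?orbT.
Qed.

(** A form outside the ideal in degree below j is not in the socle, so some
    variable keeps it outside the ideal; repeat until degree j is reached. *)
Lemma AG_pairing d e f : (d + e = j)%N -> f \is d.-homog -> f \notin I ->
  exists2 g, g \is e.-homog & f * g \notin I.
Proof.
elim: e d f => [|e IHe] d f de hf fI.
  by exists 1; rewrite ?dhomog1 // mulr1.
have [i fi] : exists i, f * 'X_i \notin I.
  apply: NNPP => nex; move/negP: fI; apply.
  apply: (@AG_socle_homog d) => // [|i]; first by lia.
  by apply: contraT => fi; case: nex; exists i.
have [||g hg fg] := IHe d.+1 (f * 'X_i) _ _ fi; [lia | exact: dhomogMX|].
exists ('X_i * g); last by rewrite mulrA.
by rewrite mulrC dhomogMX.
Qed.

Variable h : nat -> nat.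
Hypothesis hfI : hilbert_function I h.

Lemma AG_hilbert_top : h j = 1%N.
Proof.
apply/eqP; rewrite eqn_leq; apply/andP; split; last first.
  rewrite lt0n; apply/eqP => h0; have [_ [ntop _] _] := AG; apply: ntop.
  by rewrite -h0.
have [t ht tI] := AG_top_nonzero; have [_ _ [g [sg gI gsp]]] := AG.
apply: (quotient_le1 homI hfI (g := g)) => f hf; apply: gsp => i.
by apply: (@AG_above _ j.+1) => //; apply: dhomogMX.
Qed.

(** The pairing of degrees d and e with values in the one-dimensional top
    degree has trivial left kernel, so its matrix is row free. *)
Lemma AG_hilbert_le d e : (d + e = j)%N -> (h d <= h e)%N.
Proof.
move=> de.
pose b := quotient_basis hfI.
have i0 : 'I_(h j) by rewrite AG_hilbert_top; exact: ord0.
have all0 i : i = i0.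
  apply/ord_inj; have := ltn_ord i; have := ltn_ord i0.
  by rewrite [X in (_ < X)%N]AG_hilbert_top [X in (_ -> (_ < X)%N -> _)]AG_hilbert_top; lia.
pose P := \matrix_(l < h d, m < h e) coords hfI j (b d l * b e m) 0 i0.
have bh c i : b c i \is c.-homog by apply: quotient_basis_homog.
suff /eqP <- : row_free P by exact: rank_leq_col.
apply: inj_row_free => u uP; apply: (combination_free (hfI := hfI)).
apply: contraT => uI.
have [g hg /negP[]] := AG_pairing de (combination_homog hfI u) uI.
suff main c : combination hfI u * combination hfI (d := e) c \in I.
  have -> : combination hfI u * g = combination hfI u * (combination hfI (coords hfI e g))
    + combination hfI u * (g - combination hfI (coords hfI e g)).
    by rewrite -mulrDr addrC subrK.
  by apply: (idealD homI) (main _) _; apply: (idealM homI); apply: coordsP.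
have -> : combination hfI u * combination hfI c =
   \sum_m c 0 m *: \sum_l u 0 l *: (b d l * b e m).
  rewrite {2}/combination mulr_sumr; apply: eq_bigr => m _.
  rewrite -scalerAr; congr (_ *: _).
  by rewrite mulr_suml; apply: eq_bigr => l _; rewrite -scalerAl.
apply: (ideal_sum homI) => m; apply: (idealZ homI).
have hs : \sum_l u 0 l *: (b d l * b e m) \is j.-homog.
  by apply: rpred_sum => l _; rewrite rpredZ // -de dhomogM.
rewrite -(coords_eq0 homI hfI hs); apply/eqP/rowP => i; rewrite (all0 i) [RHS]mxE.
have := congr1 (fun M : 'rV_(h e) => M 0 m) uP; rewrite !mxE => <-.
transitivity ((\sum_l u 0 l *: coords hfI j (b d l * b e m)) 0 i0); last first.
  by rewrite summxE; apply: eq_bigr => l _; rewrite !mxE.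
congr (_ _ _).
have hbb l : b d l * b e m \is j.-homog by rewrite -de dhomogM.
by rewrite coords_lincomb.
Qed.

Lemma AG_hilbert_symmetric d : (d <= j)%N -> h d = h (j - d).
Proof. by move=> dj; apply/eqP; rewrite eqn_leq !AG_hilbert_le //; lia. Qed.

Lemma AG_hilbert_above d : (j < d)%N -> h d = 0%N.
Proof. by move=> jd; apply: (quotient_eq0 homI hfI) => f; apply: AG_above. Qed.

End Gorenstein.

Lemma AG_sequence_spec (k : fieldType) j h : AG_sequence k j h ->
  [/\ h 0 = 1, forall d, d <= j -> h d = h (j - d) & forall d, j < d -> h d = 0].
Proof.
move=> [I [AG hfI]]; split=> [|d|d].
- by case: AG => homI _ _; exact: hilbert_function0 homI hfI.
- exact: (AG_hilbert_symmetric AG hfI).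
- exact: (AG_hilbert_above AG hfI).
Qed.

Lemma O_sequence_spec (k : fieldType) h : O_sequence k h -> zero_seq h \/
  [/\ h 0 = 1, forall d, h d <= d -> h d.+1 <= h d & h 2 <= 'C((h 1).+1, 2)].
Proof.
case=> [|[n [I [homI hfI]]]]; [by left | right; split].
- exact: hilbert_function0 homI hfI.
- exact: hilbert_function_decr homI hfI.
- exact: hilbert_function_quadrics homI hfI.
Qed.

(** * Macaulay inverse systems of sums of monomials *)

Section InverseSystems.
Import GRing.Theory.
Local Open Scope ring_scope.
Variables (k : fieldType) (n : nat).
Implicit Types (f g : {mpoly k[n]}) (F : seq 'X_{1..n}) (m u s : 'X_{1..n}).

(** The coefficient of X^m in the contraction of the dual polynomial, the sum of
    the X^s for s in F, by f; it is the value on f X^m of the functional that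
    adds up the coefficients at F. *)
Definition contraction F m f : k := \sum_(s <- F | (m <= s)%MM) f@_(s - m).

Lemma contraction_is_linear F m : scalar (contraction F m).
Proof.
move=> a f g; rewrite /contraction mulr_sumr -big_split /=.
by apply: eq_bigr => s _; rewrite mcoeffD mcoeffZ.
Qed.

HB.instance Definition _ F m :=
  GRing.isLinear.Build k {mpoly k[n]} k *%R (contraction F m)
    (contraction_is_linear F m).

Lemma mcoeffMX_eq f u m :
  (f * 'X_[u])@_m = if (u <= m)%MM then f@_(m - u) else 0.
Proof.
case: ifPn => [um|num].
  by rewrite -{1}(submK um) addmC mcoeffMX.
apply/eqP; rewrite mcoeff_eq0 (perm_mem (msuppMX f u)); apply: contra num.
by case/mapP=> m' _ ->; apply: lem_addr.
Qed.

Lemma lem_addE m u s : (m + u <= s)%MM = (m <= s)%MM && (u <= s - m)%MM.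
Proof.
apply/mnm_lepP/andP => [le|[/mnm_lepP le1 /mnm_lepP le2] i].
  by split; apply/mnm_lepP => i; have := le i; rewrite mnmDE ?mnmBE; lia.
by have := le1 i; have := le2 i; rewrite mnmDE mnmBE; lia.
Qed.

Lemma contractionMX F m f u :
  contraction F m (f * 'X_[u]) = contraction F (m + u)%MM f.
Proof.
rewrite /contraction [RHS]big_mkcond [LHS]big_mkcond; apply: eq_bigr => s _.
by rewrite lem_addE mcoeffMX_eq; case: (m <= s)%MM => //=; rewrite submDA.
Qed.

Lemma contractionX F m u : uniq F ->
  contraction F m ('X_[u] : {mpoly k[n]}) = ((u + m)%MM \in F)%:R.
Proof.
move=> uF; rewrite -[X in contraction F m X]mul1r contractionMX /contraction addmC.
rewrite big_mkcond; case: (boolP (_ \in F)) => [umF|numF].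
  rewrite (bigD1_seq (u + m)%MM) //= lepm_refl mcoeff1.
  rewrite (_ : (u + m - (u + m))%MM = 0%MM); last first.
    by apply/mnmP => i; rewrite mnmBE mnm0E subnn.
  rewrite eqxx big1 ?addr0 // => s ne; case: ifP => // le; rewrite mcoeff1.
  case: eqP => // s0; case/eqP: ne.
  by rewrite -(submK le) s0 add0m.
rewrite big_seq_cond big1 // => s /andP[sF _]; case: ifP => // le.
rewrite mcoeff1; case: eqP => // s0; case/negP: numF.
by rewrite -[(u + m)%MM]add0m -s0 submK.
Qed.

Definition annihilates (G : seq (seq 'X_{1..n})) f :=
  forall F, F \in G -> forall m, contraction F m f = 0.

Definition inverse_ideal (G : seq (seq 'X_{1..n})) : {pred {mpoly k[n]}} :=
  fun f => if excluded_middle_informative (annihilates G f) then true else false.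

Lemma inverse_idealP G f : reflect (annihilates G f) (f \in inverse_ideal G).
Proof.
rewrite /in_mem /= /inverse_ideal.
by case: excluded_middle_informative => H; constructor.
Qed.

Variable G : seq (seq 'X_{1..n}).
Hypothesis uniqG : forall F, F \in G -> uniq F.
Hypothesis homogG : forall F, F \in G -> exists e, forall s, s \in F -> mdeg s = e.

Lemma annihilatesX u : 'X_[u] \in inverse_ideal G <->
  forall F, F \in G -> forall m, (u + m)%MM \notin F.
Proof.
split=> [/inverse_idealP X0 F FG m|X0].
  have /eqP := X0 F FG m; rewrite contractionX ?uniqG //.
  by case: (_ \in F) => //; rewrite oner_eq0.
by apply/inverse_idealP => F FG m; rewrite contractionX ?uniqG // (negPf (X0 F FG m)).
Qed.

Lemma mcoeff_pihomog d f m :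
  (pihomog mdeg d f)@_m = if mdeg m == d then f@_m else 0.
Proof.
rewrite /pihomog raddf_sum /= -big_filter.
under eq_bigr do rewrite mcoeffZ mcoeffX.
have [mf|nmf] := boolP (m \in [seq m <- msupp f | mdeg m == d]).
  rewrite (bigD1_seq m) ?filter_uniq ?msupp_uniq //= eqxx mulr1 big1 ?addr0.
    by move: mf; rewrite mem_filter => /andP[-> _].
  by move=> u ne; rewrite (negPf ne) mulr0.
rewrite big_seq big1 => [|u uf]; last first.
  by case: eqP => [um|]; rewrite ?mulr0 //; move: nmf; rewrite -um uf.
move: nmf; rewrite mem_filter mcoeff_msupp; case: eqP => //= _.
by rewrite negbK => /eqP.
Qed.

(** All monomials of F have the same degree e, so contraction at m only sees the
    component of f of degree e - deg m.  Hence the annihilator is homogeneous. *)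
Lemma contraction_pihomog F e d m f : (forall s, s \in F -> mdeg s = e) ->
  contraction F m (pihomog mdeg d f) =
  if (mdeg m + d == e)%N then contraction F m f else 0.
Proof.
move=> hF; rewrite /contraction [LHS]big_seq_cond.
have degs s : s \in F -> (m <= s)%MM -> (mdeg (s - m) == d) = (mdeg m + d == e)%N.
  by move=> sF le; rewrite -(hF s sF) -{2}(submK le) mdegD addnC eqn_add2r eq_sym.
under eq_bigr => s /andP[sF le] do rewrite mcoeff_pihomog degs //.
rewrite -big_seq_cond; case: ifP => // _; by rewrite big1.
Qed.

Lemma inverse_ideal_homogeneous :
  (exists2 F, F \in G & F != [::]) -> homogeneous_ideal (inverse_ideal G).
Proof.
move=> [F0 F0G nF0]; split; first split.
- by apply/inverse_idealP => F FG m; rewrite raddf0.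
- have [s sF0] : exists s, s \in F0.
    by case: F0 nF0 {F0G} => // s F0 _; exists s; rewrite mem_head.
  apply/negP; rewrite -mpolyX0 => /annihilatesX /(_ F0 F0G s).
  by rewrite add0m sF0.
- move=> a f g /inverse_idealP f0 /inverse_idealP g0; apply/inverse_idealP => F FG m.
  rewrite raddfD /= g0 // addr0 mulrC (mpolyE a) mulr_sumr raddf_sum big1 //= => u _.
  by rewrite -scalerAr linearZ /= contractionMX f0 // mulr0.
move=> f /inverse_idealP f0 d; apply/inverse_idealP => F FG m.
have [e hF] := homogG FG; rewrite (contraction_pihomog _ _ _ hF) f0 //.
by case: ifP.
Qed.

(** The values [(u + m)%MM \in F] over all F and m form the catalecticant row of
    the monomial u.  If the rows of B have a dual family of columns, and every
    row is zero or a row of B, then B is a basis of the quotient in degree d. *)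
Lemma inverse_ideal_quotient_dim d (B : seq 'X_{1..n}) :
  (forall u, u \in B -> mdeg u = d) ->
  (forall i, (i < size B)%N -> exists F m, F \in G /\
     forall l, (l < size B)%N -> ((nth 0%MM B l + m)%MM \in F) = (l == i)) ->
  (forall u, mdeg u = d -> (forall F, F \in G -> forall m, (u + m)%MM \notin F) \/
     exists2 v, v \in B & forall F, F \in G -> forall m,
       ((u + m)%MM \in F) = ((v + m)%MM \in F)) ->
  quotient_dim (inverse_ideal G) d (size B).
Proof.
move=> degB free span; exists (fun i => 'X_[nth 0%MM B i]); split=> [i|c|f].
- by rewrite dhomogX; apply/eqP/degB/mem_nth.
- move=> /inverse_idealP c0 i; have [F [m [FG test]]] := free i (ltn_ord i).
  have := c0 F FG m; rewrite linear_sum (bigD1 i) //= linearZ /=.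
  rewrite contractionX ?uniqG // test // eqxx mulr1 big1 ?addr0 // => l ne.
  rewrite linearZ /= contractionX ?uniqG // test //.
  by rewrite (negPf (_ : val l != val i)) ?mulr0.
move=> /dhomogP hf; rewrite (mpolyE f) big_seq_cond.
apply: (big_ind (fun g => exists c : 'I_(size B) -> k,
   g - \sum_i c i *: 'X_[nth 0%MM B i] \in inverse_ideal G)) => [|f1 f2 [c1 i1] [c2 i2]|u].
- exists (fun _ => 0); rewrite big1 ?subr0 => [|i _]; last by rewrite scale0r.
  by apply/inverse_idealP => F FG m; rewrite raddf0.
- exists (fun i => c1 i + c2 i); under eq_bigr do rewrite scalerDl.
  rewrite big_split /= opprD addrACA; move/inverse_idealP: i1 => i1.
  move/inverse_idealP: i2 => i2; apply/inverse_idealP => F FG m.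
  by rewrite raddfD /= i1 // i2 // addr0.
rewrite andbT => /hf du; have [u0|[v vB uv]] := span u du.
  exists (fun _ => 0); rewrite big1 ?subr0 => [|i _]; last by rewrite scale0r.
  apply/inverse_idealP => F FG m; rewrite linearZ /= contractionX ?uniqG //.
  by rewrite (negPf (u0 F FG m)) mulr0.
have iv : (index v B < size B)%N by rewrite index_mem.
exists (fun i => if i == Ordinal iv then f@_u else 0).
rewrite (bigD1 (Ordinal iv)) //= eqxx nth_index // big1 ?addr0 => [|i ne]; last first.
  by rewrite (negPf ne) scale0r.
apply/inverse_idealP => F FG m; rewrite -scalerBr linearZ /= raddfB /=.
by rewrite !contractionX ?uniqG // uv // subrr mulr0.
Qed.

Lemma inverse_ideal_deg_large d :
  (forall F s, F \in G -> s \in F -> (mdeg s < d)%N) ->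
  forall f, f \is d.-homog -> f \in inverse_ideal G.
Proof.
move=> small f /dhomogP hf; apply/inverse_idealP => F FG m.
rewrite /contraction big_seq_cond big1 // => s /andP[sF _].
apply/eqP; rewrite mcoeff_eq0; apply/negP => /hf md.
by have := small F s FG sF; rewrite -[d]md ltnNge mdegB.
Qed.

End InverseSystems.

Arguments inverse_ideal k [n] G _.

Section DualGenerator.
Import GRing.Theory.
Local Open Scope ring_scope.

(** Let s0 be a monomial of F.  A socle element f is annihilated by contraction
    at every m of positive degree, because f X^m is a multiple of some f x_i;
    so modulo the ideal only the value of f at m = 0 matters, and X^s0 has value
    1 there. *)
Lemma inverse_ideal_AG (k : fieldType) n (F : seq 'X_{1..n}) j :
  uniq F -> F != [::] -> (forall s, s \in F -> mdeg s = j) ->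
  AG_ideal (inverse_ideal k [:: F]) j.
Proof.
move=> uF nF hF; set G := [:: F].
have uG F' : F' \in G -> uniq F' by rewrite inE => /eqP ->.
have hG F' : F' \in G -> exists e, forall s, s \in F' -> mdeg s = e.
  by rewrite inE => /eqP ->; exists j.
have FG : F \in G by apply: mem_head.
have [s0 s0F] : exists s, s \in F.
  by case: (F) nF => // s F0 _; exists s; rewrite mem_head.
have s0I : 'X_[s0] \notin inverse_ideal k G.
  apply/negP => /(annihilatesX k uG) /(_ F FG 0%MM).
  by rewrite addm0 s0F.
have large d : (j < d)%N ->
    forall f : {mpoly k[n]}, f \is d.-homog -> f \in inverse_ideal k G.
  by move=> jd; apply: inverse_ideal_deg_large => F' s; rewrite inE => /eqP -> /hF ->.
split.
- by apply: inverse_ideal_homogeneous => //; exists F.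
- split=> [[b [_ _ span]]|d jd].
    have [|c] := span 'X_[s0]; first by rewrite dhomogX; apply/eqP/hF.
    by rewrite big_ord0 subr0 => s0I'; rewrite s0I' in s0I.
  exists (fun _ => 0); split=> [[]//|c _ []//|f hf].
  by exists (fun _ => 0); rewrite big_ord0 subr0; apply: large hf.
exists 'X_[s0]; split=> // [i|f /= sf].
  by apply: (large j.+1) => //; apply: dhomogMX; rewrite dhomogX; apply/eqP/hF.
exists (contraction F 0%MM f); apply/inverse_idealP => F'; rewrite inE => /eqP -> m.
rewrite linearB linearZ /= contractionX //.
have [->|nm] := eqVneq m 0%MM.
  by rewrite addm0 s0F mulr1 subrr.
have [i mi] : exists i, (0 < m i)%N.
  apply/existsP; apply: contraR nm => /existsPn m0; apply/eqP/mnmP => i.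
  by rewrite mnm0E; apply/eqP; rewrite -leqn0 leqNgt m0.
have -> : m = ((m - U_(i)) + U_(i))%MM.
  by apply/mnmP => l; rewrite mnmDE mnmBE mnm1E; case: eqP => [<-|_] /=; lia.
rewrite -contractionMX; have /inverse_idealP -> // := sf i.
rewrite (_ : (_ \in F) = false) ?mulr0 ?subr0 //.
apply/negP => /hF; rewrite !mdegD (hF _ s0F) mdeg1; lia.
Qed.

End DualGenerator.

(** * Decidable Hilbert functions in three variables *)

(** Exponents as plain triples, on which everything below computes. *)
Definition triple := (nat * nat * nat)%type.

Definition mon (t : triple) : 'X_{1..3} :=
  [multinom nth 0 [:: t.1.1; t.1.2; t.2] i | i < 3].

Definition degree (t : triple) := t.1.1 + t.1.2 + t.2.
Definition divides (t u : triple) := [&& t.1.1 <= u.1.1, t.1.2 <= u.1.2 & t.2 <= u.2].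
Definition quotient (t u : triple) : triple := (t.1.1 - u.1.1, t.1.2 - u.1.2, t.2 - u.2).

Definition var_x : 'I_3 := @Ordinal 3 0 isT.
Definition var_y : 'I_3 := @Ordinal 3 1 isT.
Definition var_z : 'I_3 := @Ordinal 3 2 isT.

Lemma mon_surj (m : 'X_{1..3}) : m = mon (m var_x, m var_y, m var_z).
Proof.
by apply/mnmP => -[[|[|[|//]]] lt]; rewrite mnmE /=; congr (m _); apply/val_inj.
Qed.

Lemma mon_inj : injective mon.
Proof.
move=> [[a b] c] [[a' b'] c'] /mnmP e.
by have := e var_x; have := e var_y; have := e var_z; rewrite !mnmE /= => -> -> ->.
Qed.

Lemma mdeg_mon t : mdeg (mon t) = degree t.
Proof. by rewrite mdegE !big_ord_recl big_ord0 !mnmE /= addn0 addnA. Qed.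

Lemma monD t u : (mon t + mon u)%MM = mon (t.1.1 + u.1.1, t.1.2 + u.1.2, t.2 + u.2).
Proof. by apply/mnmP => -[[|[|[|//]]] lt]; rewrite mnmDE !mnmE. Qed.

Definition cofactors (F : seq triple) (u : triple) :=
  [seq quotient s u | s <- F & divides u s].

(** The cofactors of u in F are the support of the catalecticant row of u. *)
Lemma mem_cofactors F u t :
  ((mon u + mon t)%MM \in map mon F) = (t \in cofactors F u).
Proof.
rewrite monD (mem_map mon_inj); apply/idP/mapP => [utF|[s]].
  exists (u.1.1 + t.1.1, u.1.2 + t.1.2, u.2 + t.2).
    by rewrite mem_filter utF /divides /= !leq_addr.
  by rewrite /quotient /= !addKn; case: (t) => -[].
rewrite mem_filter => /andP[/and3P[l1 l2 l3] sF] -> /=.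
by rewrite !subnKC //; case: (s) sF => -[].
Qed.

Definition monomials (d : nat) : seq triple :=
  [seq (a, b, d - a - b) | a <- iota 0 d.+1, b <- iota 0 (d - a).+1].

Lemma mem_monomials d t : degree t = d -> t \in monomials d.
Proof.
case: t => -[a b] c; rewrite /degree /= => dt.
apply/allpairsPdep; exists a, b; rewrite !mem_iota; split; [lia|lia|].
by congr (_, _, _); lia.
Qed.

Definition nonzero_at (G : seq (seq triple)) u :=
  has (fun F => ~~ nilp (cofactors F u)) G.
Definition same_at (G : seq (seq triple)) u v :=
  all (fun F => cofactors F u == cofactors F v) G.
Definition disjoint_at (G : seq (seq triple)) u v :=
  all (fun F => ~~ has (mem (cofactors F u)) (cofactors F v)) G.

(** Pairwise disjoint nonzero rows are independent, with dual columns found in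
    their supports.  Rows are compared as lists: this is finer than equality of
    supports, hence still sound. *)
Definition is_basis (G : seq (seq triple)) d (B : seq triple) :=
  [&& all (fun u => degree u == d) B, all (nonzero_at G) B,
      pairwise (disjoint_at G) B
    & all (fun u => ~~ nonzero_at G u || has (same_at G u) B) (monomials d)].

(** A heuristic choice: the conditions that make it a basis are checked
    separately by [is_basis]. *)
Definition greedy_basis (G : seq (seq triple)) d :=
  foldr (fun u B => if nonzero_at G u && ~~ has (same_at G u) B then u :: B else B)
    [::] (monomials d).

Definition has_hilbert_function (G : seq (seq triple)) (h : seq nat) :=
  [&& has (fun F => ~~ nilp F) G, all uniq G,
      all (fun F => constant (map degree F)) G,
      all (all (fun s => degree s < size h)) G
    & all (fun d => let B := greedy_basis G d in
                    (size B == nth 0 h d) && is_basis G d B) (iota 0 (size h))].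

Definition mons (G : seq (seq triple)) := map (map mon) G.

Lemma disjoint_at_sym G u v : disjoint_at G u v = disjoint_at G v u.
Proof. by apply: eq_all => F; rewrite has_sym. Qed.

Lemma is_basis_quotient_dim (k : fieldType) G d B :
  all uniq G -> is_basis G d B -> quotient_dim (inverse_ideal k (mons G)) d (size B).
Proof.
move=> /allP uG /and4P[/allP degB /allP nzB disB /allP spanB].
rewrite -(size_map mon B); apply: inverse_ideal_quotient_dim.
- by move=> F /mapP[F' F'G ->]; rewrite (map_inj_uniq mon_inj) uG.
- by move=> u /mapP[t tB ->]; rewrite mdeg_mon; apply/eqP/degB.
- rewrite size_map => i lti; pose u := nth (0, 0, 0) B i.
  have uB : u \in B by apply: mem_nth.
  have /hasP[F FG] := nzB u uB.
  case E: (cofactors F u) => [//|t r] _.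
  exists (map mon F), (mon t); split; first by apply: map_f.
  move=> l ltl; rewrite (nth_map (0, 0, 0)) // mem_cofactors.
  have [->|ne] := eqVneq l i; first by rewrite -/u E mem_head.
  have : disjoint_at G u (nth (0, 0, 0) B l).
    have /(pairwiseP (0, 0, 0)) dis := disB.
    case: (ltngtP l i) => [li|il|eq]; last by rewrite eq eqxx in ne.
      by rewrite disjoint_at_sym; apply: dis.
    by apply: dis.
  move/allP/(_ F FG)/hasPn => dis; apply/negP => /dis.
  by rewrite /= E mem_head.
move=> m degm; rewrite (mon_surj m); set u := (_, _, _).
have du : degree u = d by rewrite -mdeg_mon -mon_surj.
case/orP: (spanB u (mem_monomials du)) => [zu|/hasP[v vB /allP uv]]; [left|right].
  move=> F /mapP[F' F'G ->] m'; rewrite (mon_surj m') mem_cofactors.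
  by have /hasPn/(_ F' F'G) := zu; rewrite negbK => /nilP ->.
exists (mon v); first exact: map_f.
move=> F /mapP[F' F'G ->] m'; rewrite (mon_surj m') !mem_cofactors.
by rewrite (eqP (uv F' F'G)).
Qed.

Lemma has_hilbert_functionP (k : fieldType) G h : has_hilbert_function G h ->
  homogeneous_ideal (inverse_ideal k (mons G)) /\
  hilbert_function (inverse_ideal k (mons G)) (nth 0 h).
Proof.
case/and5P => /hasP[F0 F0G nF0] uG /allP homG /allP boundG /allP basisG; split.
  apply: inverse_ideal_homogeneous.
  - by move=> F /mapP[F' F'G ->]; rewrite (map_inj_uniq mon_inj) (allP uG).
  - move=> F /mapP[F' F'G ->].
    have := homG F' F'G; case: F' {F'G} => [|t F'] /=; first by exists 0.
    move=> /allP deg; exists (degree t) => s; rewrite inE => /orP[/eqP ->|].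
      by rewrite mdeg_mon.
    by case/mapP=> u uF' ->; rewrite mdeg_mon; apply/eqP/deg/map_f.
  - by exists (map mon F0); [apply: map_f | case: (F0) nF0].
move=> d; case: (ltnP d (size h)) => [lt|ge].
  have /andP[/eqP <- isB] := basisG d ltac:(by rewrite mem_iota).
  exact: is_basis_quotient_dim.
rewrite nth_default //; exists (fun _ => 0%R); split=> [[]//|c _ []//|f hf].
exists (fun _ => 0%R); rewrite big_ord0 GRing.subr0.
apply: inverse_ideal_deg_large hf => F s /mapP[F' F'G ->] /mapP[t tF' ->].
by rewrite mdeg_mon; apply: leq_trans ge; apply: (allP (boundG F' F'G)).
Qed.

Definition generates_AG (F : seq triple) j (h : seq nat) :=
  all (fun s => degree s == j) F && has_hilbert_function [:: F] h.

Lemma generates_AGP (k : fieldType) F j h :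
  generates_AG F j h -> AG_sequence k j (nth 0 h).
Proof.
case/andP => /allP degF hfF; have [_ hf] := has_hilbert_functionP k hfF.
exists (inverse_ideal k (mons [:: F])); split=> //.
case/and5P: hfF => /= nF uF _ _ _; rewrite orbF in nF; rewrite andbT in uF.
apply: inverse_ideal_AG.
- by rewrite (map_inj_uniq mon_inj).
- by case: (F) nF.
- by move=> s /mapP[t tF ->]; rewrite mdeg_mon; apply/eqP/degF.
Qed.

(** Dual generators, by the socle degree j, the value b in degree 1 and the
    maximum c of the Hilbert function.  For c = 1, 2 and for b = c = 3 they are
    power sums.  For c = 3 and b = 2 and for c = 4 they are monomials, whose
    annihilators are complete intersections.  For c = 5 the generator is
    X^(j-2) Y^2 + Y Z^(j-1), apolar to a scheme of length 5 on the conic xz = 0,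
    of length 3 at one point and of length 2 at another. *)
Definition dual_generator (j b c : nat) : seq triple :=
  match c with
  | 1 => [:: (j, 0, 0)]
  | 2 => [:: (j, 0, 0); (0, j, 0)]
  | 3 => if b == 2 then [:: (j - 2, 2, 0)] else [:: (j, 0, 0); (0, j, 0); (0, 0, j)]
  | 4 => [:: (j - 2, 1, 1)]
  | _ => [:: (j - 2, 2, 0); (0, 1, j - 1)]
  end.

Definition AG_witnessed j (h : seq nat) :=
  generates_AG (dual_generator j (nth 0 h 1) (foldr maxn 0 h)) j h.

(** Macaulay's extremal example: [monomials] lists each degree in increasing
    lexicographic order, and the h_d smallest monomials of the degrees d form a
    set closed under divisors when h is an O-sequence. *)
Definition lex_order_ideal (h : seq nat) : seq triple :=
  flatten [seq take (nth 0 h d) (monomials d) | d <- iota 0 (size h)].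

Definition O_witnessed (h : seq nat) :=
  has_hilbert_function [seq [:: u] | u <- lex_order_ideal h] h.

Lemma O_witnessedP (k : fieldType) h : O_witnessed h -> O_sequence k (nth 0 h).
Proof.
by move=> hw; right; exists 3; eexists; exact: has_hilbert_functionP hw.
Qed.

(** * The finite search *)

Definition hilbertT := [:: 1; 3; 5; 5; 5; 3; 1].

Definition entry_of (c : seq (seq nat)) u v :=
  if u <= v then nth 0 (nth [::] c (v - u)) u else 0.

Definition upper7 (P : nat -> nat -> bool) :=
  all (fun u => all (fun v => (u <= v) ==> P u v) (iota 0 7)) (iota 0 7).

Definition rows_ok (m : nat -> nat -> nat) :=
  upper7 (fun u v => (v < 6) ==> (m u v.+1 <= m u v)).
Definition cols_ok (m : nat -> nat -> nat) :=
  upper7 (fun u v => (u < v) ==> (m u v <= m u.+1 v)).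
Definition squares_ok (m : nat -> nat -> nat) :=
  upper7 (fun u v => (u < v < 6) ==> (m u v + m u.+1 v.+1 <= m u.+1 v + m u v.+1)).
(** T takes its maximal value 5 exactly in degrees 2, 3 and 4, so these are the
    only equalities between entries at equal distance from the main diagonal
    that its plateau imposes. *)
Definition plateau_ok (m : nat -> nat -> nat) :=
  [&& m 2 2 == m 3 3, m 3 3 == m 4 4 & m 2 3 == m 3 4].

Definition difference (m : nat -> nat -> nat) i d :=
  m d (d + i) - shift (fun e => m e (e + i.+1)) d.

(** The necessary conditions of [O_sequence_spec] in the degrees that matter; a
    difference of diagonals vanishes from degree 7 on. *)
Definition growth_ok (h : nat -> nat) :=
  all (fun d => h d == 0) (iota 0 8) ||
  [&& h 0 == 1, all (fun d => (h d <= d) ==> (h d.+1 <= h d)) (iota 0 7)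
    & h 2 <= 'C((h 1).+1, 2)].

Definition differences_ok (m : nat -> nat -> nat) :=
  all (fun i => all (fun d => shift (fun e => m e (e + i.+1)) d <= m d (d + i)) (iota 0 7)
                && growth_ok (difference m i)) (iota 0 7).

(** For L <= 6 the distance of d to the nearer end is at most 2. *)
Definition symmetric_seq L b c :=
  mkseq (fun d => nth 0 [:: 1; b; c] (minn d (L.-1 - d))) L.

Definition diagonal_candidates i :=
  nseq (7 - i) 0 :: undup [seq symmetric_seq (7 - i) b c | b <- iota 0 4, c <- iota 0 6].

Definition admissible (c : seq (seq nat)) :=
  let m := entry_of c in
  [&& rows_ok m, cols_ok m, squares_ok m, m 0 1 != 0, plateau_ok m & differences_ok m].

(** Monotonicity of rows and columns between the first two diagonals of c,
    imposed while the lists are built to keep the search small. *)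
Definition nested (c : seq (seq nat)) :=
  if c is H :: H' :: _ then
    all (fun d => (nth 0 H' d <= nth 0 H d) && (nth 0 H' d <= nth 0 H d.+1)) (iota 0 7)
  else true.

Definition extend i (cs : seq (seq (seq nat))) :=
  [seq c <- [seq H :: c | H <- diagonal_candidates i, c <- cs] | nested c].

Fixpoint candidates i n : seq (seq (seq nat)) :=
  if n is n'.+1 then extend i (candidates i.+1 n') else [:: [::]].

Definition potential_diagonals :=
  [seq c <- map (cons hilbertT) (candidates 1 6) | admissible c].

(** * Rank matrices as lists of diagonals *)

Lemma entryE m (M : 'M[nat]_m) (i j : 'I_m) : entry M i j = M i j.
Proof. by rewrite /entry !valK. Qed.

Lemma entry_out m (M : 'M[nat]_m) u v : (m <= u) || (m <= v) -> entry M u v = 0.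
Proof.
rewrite /entry => /orP[out|out].
  by rewrite insubF // ltnNge out.
by case: insubP => // i _ _; rewrite insubF // ltnNge out.
Qed.

Lemma diagonal_out m (M : 'M[nat]_m) i d : m - i <= d -> diagonal M i d = 0.
Proof. by move=> le; apply: entry_out; lia. Qed.

Lemma entry_of_diagonal c i d : entry_of c d (d + i) = nth 0 (nth [::] c i) d.
Proof. by rewrite /entry_of leq_addr addKn. Qed.

Definition matrix_of (c : seq (seq nat)) : 'M[nat]_7 :=
  \matrix_(i, j) entry_of c i j.

Definition diagonals_of (M : 'M[nat]_7) : seq (seq nat) :=
  mkseq (fun i => mkseq (diagonal M i) (7 - i)) 7.

Lemma entry_matrix_of c : shape c = [:: 7; 6; 5; 4; 3; 2; 1] ->
  entry (matrix_of c) = entry_of c.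
Proof.
move=> shc; have size_c i : size (nth [::] c i) = 7 - i.
  have [lt|ge] := ltnP i (size c); last first.
    rewrite nth_default //=; move: ge; rewrite -(size_map size) -/(shape c) shc /=; lia.
  rewrite -(nth_map _ 0) // -/(shape c) shc.
  by move: lt; rewrite -(size_map size) -/(shape c) shc; do 7!case: i => // i.
apply: functional_extensionality => u; apply: functional_extensionality => v.
have [uv|vu] := leqP u v; last first.
  rewrite [RHS]/entry_of leqNgt vu /=.
  have [u7|u7] := ltnP u 7; last by rewrite entry_out ?u7.
  have v7 := ltn_trans vu u7.
  rewrite (entryE (matrix_of c) (Ordinal u7) (Ordinal v7)) mxE /entry_of /=.
  by rewrite leqNgt vu.
have [v7|v7] := ltnP v 7.
  have u7 := leq_ltn_trans uv v7.
  by rewrite (entryE (matrix_of c) (Ordinal u7) (Ordinal v7)) mxE.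
rewrite entry_out ?v7 ?orbT // /entry_of uv nth_default // size_c; lia.
Qed.

Lemma entry_of_diagonals_of (M : 'M[nat]_7) : (forall u v, v < u -> entry M u v = 0) ->
  entry_of (diagonals_of M) = entry M.
Proof.
move=> low; apply: functional_extensionality => u; apply: functional_extensionality => v.
rewrite /entry_of; case: ifPn => [uv|]; last by rewrite -ltnNge => /low ->.
have [lt|ge] := ltnP (v - u) 7; last first.
  by rewrite [nth [::] _ _]nth_default ?size_mkseq // nth_nil entry_out //; lia.
rewrite nth_mkseq //; have [ltu|geu] := ltnP u (7 - (v - u)).
  by rewrite nth_mkseq // /diagonal subnKC.
by rewrite nth_default ?size_mkseq // entry_out //; lia.
Qed.

Lemma diagonals_ofK (M : 'M[nat]_7) : (forall u v, v < u -> entry M u v = 0) ->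
  matrix_of (diagonals_of M) = M.
Proof.
by move=> low; apply/matrixP => i j; rewrite mxE entry_of_diagonals_of // entryE.
Qed.

Lemma upper7P (P : nat -> nat -> bool) :
  reflect (forall u v, u <= v -> v < 7 -> P u v) (upper7 P).
Proof.
apply: (iffP allP) => [h u v uv v7|h u].
  have /allP/(_ v) := h u ltac:(rewrite mem_iota; lia).
  by rewrite mem_iota v7 uv => /(_ isT).
rewrite mem_iota => u7; apply/allP => v; rewrite mem_iota => v7.
by apply/implyP => uv; apply: h.
Qed.

Lemma maxT : \max_(t <- hilbertT) t = 5.
Proof. by rewrite !big_cons big_nil. Qed.

Lemma growth_okP (k : fieldType) h : O_sequence k h -> growth_ok h.
Proof.
move=> /O_sequence_spec [h0|[h0 decr quad]]; apply/orP; [left|right].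
  by apply/allP => d _; rewrite h0.
rewrite h0 eqxx quad andbT; apply/allP => d _; apply/implyP; exact: decr.
Qed.

Lemma symmetric_seqP (h : nat -> nat) L : 0 < L <= 6 -> h 0 = 1 ->
  (forall d, d < L -> h d = h (L.-1 - d)) ->
  mkseq h L = symmetric_seq L (h 1) (h 2).
Proof.
move=> L6 h0 sym; apply/eq_in_map => d; rewrite mem_iota add0n => /andP[_ dL].
have -> : h d = h (minn d (L.-1 - d)).
  by rewrite /minn; case: ifP => // _; exact: sym.
have : minn d (L.-1 - d) < 3 by lia.
by case: (minn _ _) => [|[|[|]]].
Qed.

Lemma mem_candidates (D : nat -> seq nat) i n :
  (forall l, i <= l < i + n -> D l \in diagonal_candidates l) ->
  (forall l d, nth 0 (D l.+1) d <= nth 0 (D l) d /\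
               nth 0 (D l.+1) d <= nth 0 (D l) d.+1) ->
  map D (iota i n) \in candidates i n.
Proof.
move=> + mono; elim: n i => [|n IH] i Di; first exact: mem_head.
rewrite -[candidates _ _]/(extend i (candidates i.+1 n)) mem_filter.
apply/andP; split.
  case: (n) => // n'; rewrite -[nested _]/(all _ _); apply/allP => d _.
  by have [-> ->] := mono i d.
apply/allpairsPdep; exists (D i), (map D (iota i.+1 n)); split=> //.
  by apply: Di; lia.
by apply: IH => l ls; apply: Di; lia.
Qed.

Lemma nth_diagonal (M : 'M[nat]_7) i d :
  nth 0 (mkseq (diagonal M i) (7 - i)) d = diagonal M i d.
Proof.
have [lt|ge] := ltnP d (7 - i); first by rewrite nth_mkseq.
by rewrite nth_default ?size_mkseq // diagonal_out.
Qed.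

Section Necessity.
Variables (k : fieldType) (M : 'M[nat]_7).
Hypothesis prM : potential_rank_matrix (T := hilbertT) k M.

Lemma potential_lower u v : v < u -> entry M u v = 0.
Proof. by case: prM => low _ _ _ _; exact: low. Qed.

Lemma potential_entry_le u v : u <= v -> v < 7 -> entry M u v <= nth 0 hilbertT u.
Proof.
case: prM => _ [dT _ _] _ [rows _] _.
elim: v => [|v IH] uv v7.
  by move: uv; rewrite leqn0 => /eqP ->; rewrite -dT.
have [->|ne] := eqVneq u v.+1; first by rewrite -dT /diagonal addn0.
by apply: leq_trans (rows _ _ _ _) (IH _ _) => //=; lia.
Qed.

Lemma potential_diagonal i : 0 < i < 7 ->
  mkseq (diagonal M i) (7 - i) \in diagonal_candidates i.
Proof.
move=> i7; case: (prM) => _ [_ _ AG] _ _ _.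
have [|z|/AG_sequence_spec[h0 sym _]] := AG i; first by rewrite /=; lia.
  rewrite inE; apply/orP; left; apply/eqP/(@eq_from_nth _ 0) => [|d].
    by rewrite size_mkseq size_nseq.
  by rewrite size_mkseq => lt; rewrite nth_mkseq // z nth_nseq lt.
rewrite inE mem_undup; apply/orP; right; rewrite symmetric_seqP //; last 2 first.
- lia.
- move=> d dL; rewrite sym //=; last by lia.
  by congr (diagonal _ _ _); lia.
have b4 : diagonal M i 1 < 4.
  have [lt|ge] := ltnP (1 + i) 7; first exact: (potential_entry_le (u := 1)).
  by rewrite diagonal_out //; lia.
have c6 : diagonal M i 2 < 6.
  have [lt|ge] := ltnP (2 + i) 7; first exact: (potential_entry_le (u := 2)).
  by rewrite diagonal_out //; lia.
by apply/allpairsPdep; exists (diagonal M i 1), (diagonal M i 2); rewrite !mem_iota.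
Qed.

Lemma potential_diagonals_of : diagonals_of M \in potential_diagonals.
Proof.
have E := entry_of_diagonals_of potential_lower.
rewrite mem_filter; apply/andP; split.
  rewrite /admissible E; case: (prM) => low [dT nz AG] diff [rows cols] [sq plat].
  rewrite maxT in plat; apply/and5P; split; last (apply/andP; split).
  - by apply/upper7P => u v uv v7; apply/implyP; apply: rows.
  - by apply/upper7P => u v uv v7; apply/implyP => lt; apply: cols.
  - by apply/upper7P => u v uv v7; apply/implyP => /andP[]; apply: sq.
  - apply/eqP => z; apply: nz; have [//|/AG_sequence_spec[h0 _ _]] := AG 1 isT.
    by move: h0; rewrite /diagonal add0n z.
  - by apply/and3P; split; apply/eqP; apply: plat.
  apply/allP => i; rewrite mem_iota => i7.
  have [|h Oh hE] := diff i; first by rewrite /=; lia.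
  have {}hE d : entry M d (d + i) = shift (fun e => entry M e (e + i.+1)) d + h d.
    exact: hE.
  apply/andP; split; first by apply/allP => d _; rewrite hE leq_addr.
  suff -> : difference (entry M) i = h by exact: growth_okP Oh.
  by apply: functional_extensionality => d; rewrite /difference hE addKn.
apply/mapP; exists [seq mkseq (diagonal M i) (7 - i) | i <- iota 1 6].
  apply: mem_candidates => [i|i d]; first exact: potential_diagonal.
  rewrite !nth_diagonal; case: (prM) => low _ _ [rows cols] _.
  have [v7|v7] := ltnP (d + i.+1) 7; last by rewrite (@diagonal_out _ _ i.+1) //; lia.
  rewrite /diagonal addSn -addnS; split; last by apply: cols => /=; lia.
  by rewrite addnS; apply: rows => /=; lia.
rewrite (_ : diagonals_of M = [seq mkseq (diagonal M i) (7 - i) | i <- 0 :: iota 1 6]) //.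
rewrite map_cons.
congr (_ :: _); case: (prM) => _ [dT _ _] _ _ _.
by apply: (@eq_from_nth _ 0) => [|d]; rewrite size_mkseq // => lt; rewrite nth_mkseq.
Qed.

End Necessity.

(** The shape says that the i-th diagonal has 7 - i entries, so that
    [entry_of c] vanishes outside the matrix. *)
Definition witnessed (c : seq (seq nat)) :=
  [&& shape c == [:: 7; 6; 5; 4; 3; 2; 1], nth [::] c 0 == hilbertT,
      all (fun i => let h := nth [::] c i in
             all (pred1 0) h || AG_witnessed (6 - i) h) (iota 0 7)
    & all (fun i => let h := mkseq (difference (entry_of c) i) (7 - i) in
             all (pred1 0) h || O_witnessed h) (iota 0 7)].

Lemma potential_diagonals_witnessed : all witnessed potential_diagonals.
Proof. by vm_compute. Qed.

Lemma size_potential_diagonals : size potential_diagonals = 43.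
Proof. by vm_compute. Qed.

Lemma nth_all0 s d : all (pred1 0) s -> nth 0 s d = 0.
Proof.
move=> /allP z; have [lt|ge] := ltnP d (size s); last exact: nth_default.
by apply/eqP/z/mem_nth.
Qed.

Lemma potential_matrix_of (k : fieldType) c : c \in potential_diagonals ->
  potential_rank_matrix (T := hilbertT) k (matrix_of c).
Proof.
move=> cP; have /and4P[/eqP shc /eqP c0 /allP agc /allP oc] :=
  allP potential_diagonals_witnessed c cP.
have E := entry_matrix_of shc.
have D i : diagonal (matrix_of c) i = nth 0 (nth [::] c i).
  by apply: functional_extensionality => d; rewrite /diagonal E entry_of_diagonal.
move: cP; rewrite mem_filter => /andP[+ _].
move=> /and5P[/upper7P rows /upper7P cols /upper7P sq nz /andP[plat /allP diff]].
rewrite /potential_rank_matrix E maxT /=; split.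
- by move=> u v vu; rewrite /entry_of leqNgt vu.
- split=> [d|z|i i6]; first by rewrite D c0.
    by move: (z 0) nz; rewrite /diagonal E => ->.
  have /agc/orP[z|w] : i \in iota 0 7 by rewrite mem_iota.
    by left=> d; rewrite D nth_all0.
  by right; rewrite D; apply: generates_AGP w.
- move=> i i6; have i7 : i \in iota 0 7 by rewrite mem_iota.
  set h := mkseq (difference (entry_of c) i) (7 - i).
  exists (nth 0 h).
    by have /orP[z|w] := oc i i7; [left=> d; rewrite nth_all0 | exact: O_witnessedP w].
  move=> d; have [lt|ge] := ltnP d (7 - i).
    rewrite nth_mkseq // /difference /diagonal E.
    have /andP[/allP/(_ d) le _] := diff i i7.
    by rewrite subnKC // le // mem_iota; lia.
  rewrite diagonal_out // [nth _ _ _]nth_default ?size_mkseq //.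
  by case: d ge => [|d] ge //=; rewrite diagonal_out //; lia.
- split=> u v.
    by move=> uv v6; apply: (implyP (rows u v _ _)) => //; lia.
  by move=> uv v6; apply: (implyP (cols u v _ _)) => //; lia.
- split=> [u v uv v6|u v u' v'].
    by apply: (implyP (sq u v _ _)); rewrite ?uv //; lia.
  have mid w : w <= 6 -> nth 0 hilbertT w = 5 -> [\/ w = 2, w = 3 | w = 4].
    case: w => [|[|[|[|[|[|[|w]]]]]]] //= _ _.
    - by constructor 1.
    - by constructor 2.
    - by constructor 3.
  move=> uv v6 uv' v6' /mid mu /mid mv /mid mu' /mid mv'.
  have /and3P[/eqP p1 /eqP p2 /eqP p3] := plat.
  have {}mu := mu ltac:(lia); have {}mv := mv v6.
  have {}mu' := mu' ltac:(lia); have {}mv' := mv' v6'.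
  case: mu mv mu' mv' uv uv' => -> [] -> [] -> [] -> //; by rewrite ?p1 ?p2 ?p3.
Qed.

Lemma potential_rank_matrixE (k : fieldType) (M : 'M[nat]_7) :
  potential_rank_matrix (T := hilbertT) k M <-> M \in map matrix_of potential_diagonals.
Proof.
split=> [prM|/mapP[c cP ->]]; last exact: potential_matrix_of.
rewrite -(diagonals_ofK (potential_lower prM)).
exact/map_f/(potential_diagonals_of prM).
Qed.

(** * Jordan degree types *)

Lemma msetD_sumE (K : choiceType) (J : Type) (r : seq J) (P : pred J)
    (A : J -> {mset K}%mset) x :
  (\big[@msetD K/mset0%mset]_(i <- r | P i) A i) x = \sum_(i <- r | P i) A i x.
Proof.
by apply: (big_morph (fun B : {mset K}%mset => B x)) => [B C|]; rewrite ?msetE2 ?mset0E.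
Qed.

(** The pair (length, initial degree) determines the string (u, v), so only one
    term of the double sum contributes. *)
Lemma jordan_degree_type_mult m (M : 'M[nat]_m) (u v : 'I_m) : u <= v ->
  jordan_degree_type M (v - u + 1, nat_of_ord u) = string_mult M u v.
Proof.
move=> uv; rewrite msetD_sumE (bigD1 u) //= msetD_sumE (bigD1 v) //= msetnxx.
rewrite big1 => [|w /andP[uw ne]]; last first.
  rewrite msetnE; case: eqP => // -[] e; case/eqP: ne; apply/val_inj => /=; lia.
rewrite addn0 big1 ?addn0 // => u' ne; rewrite msetD_sumE big1 // => w _.
by rewrite msetnE; case: eqP => // -[] _ e; case/eqP: ne; apply/val_inj.
Qed.

Definition string_mult_of (m : nat -> nat -> nat) u v :=
  (m u v + shift (fun w => m w v.+1) u) - (shift (fun w => m w v) u + m u v.+1).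

(** Reading all multiplicities of a Jordan degree type gives a list of numbers,
    and the 43 lists are distinct. *)
Lemma jordan_degree_types_uniq :
  uniq [seq jordan_degree_type (matrix_of c) | c <- potential_diagonals].
Proof.
pose read (D : {mset (nat * nat)%type}%mset) :=
  [seq D (v - u + 1, u) | u <- iota 0 7, v <- iota u (7 - u)].
apply: (@map_uniq _ _ read); rewrite -map_comp.
have -> : map (read \o (fun c => jordan_degree_type (matrix_of c))) potential_diagonals =
  [seq [seq string_mult_of (entry_of c) u v | u <- iota 0 7, v <- iota u (7 - u)]
     | c <- potential_diagonals].
  apply/eq_in_map => c cP /=.
  have /and4P[/eqP shc _ _ _] := allP potential_diagonals_witnessed c cP.
  apply/eq_in_allpairs_dep => u + v; rewrite !mem_iota => u7 v7.
  have lu : u < 7 by []. have lv : v < 7 by lia.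
  rewrite (@jordan_degree_type_mult _ _ (Ordinal lu) (Ordinal lv)) /=; last by lia.
  by rewrite /string_mult entry_matrix_of.
by vm_compute.
Qed.

Lemma potential_jordan_degree_typeE (k : fieldType) D :
  potential_jordan_degree_type k hilbertT D <->
  D \in [seq jordan_degree_type (matrix_of c) | c <- potential_diagonals].
Proof.
split=> [[M /potential_rank_matrixE /mapP[c cP ->] ->]|/mapP[c cP ->]].
  by apply/mapP; exists c.
exists (matrix_of c); [exact: potential_matrix_of | exact: erefl].
Qed.

Theorem theorem3p8 (k : fieldType) (hk : infinite_field k) :
  let T : seq nat := ([:: 1; 3] ++ nseq 3 5 ++ [:: 3; 1])%N in
  has_exactly 43 (fun D : {mset (nat * nat)%type}%mset =>
                    potential_jordan_degree_type k T D) /\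
  has_exactly 43 (fun M : 'M[nat]_(size T) => potential_rank_matrix k M).
Proof.
split.
  exists [seq jordan_degree_type (matrix_of c) | c <- potential_diagonals]; split.
  - exact: jordan_degree_types_uniq.
  - by rewrite size_map size_potential_diagonals.
  - by move=> D; split=> /(potential_jordan_degree_typeE k).
exists (map matrix_of potential_diagonals); split.
- apply: (@map_uniq _ _ (@jordan_degree_type 7)); rewrite -map_comp.
  exact: jordan_degree_types_uniq.
- by rewrite size_map size_potential_diagonals.
- by move=> M; split=> /(potential_rank_matrixE k).
Qed.
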